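(* Let $m,s\in\mathbb N$, let $\mathcal F$ be an $m$-block Ferrers diagram of order $sm$, let $d\in[sm]$, and let $D^B_{\max}:=\max_{i\in[s]}|D_i^B\cap\mathbf B(\mathcal F)|$. Then for every prime power $q\ge D^B_{\max}+1$, the diagonal MSRD construction described in the context provides a linear $[\mathcal F,k,d]_q$ Ferrers diagram rank-metric code $\mathcal C$ of dimension $$k=m\left(\sum_{i=1}^s\max\{0,\;m|D_i^B\cap\mathbf B(\mathcal F)|-d+1\}\right).$$
   Context: Notation: $\mathbb N=\{1,2,\dots\}$ and $[n]=\{1,\dots,n\}$, $[0]=\emptyset$. A (top-right justified) Ferrers diagram of order $n$ is a subset $\mathcal F\subseteq[n]^2$ such that (1) $(i,j)\in\mathcal F$ and $j<n$ imply $(i,j+1)\in\mathcal F$; (2) $(i,j)\in\mathcal F$ and $i>1$ imply $(i-1,j)\in\mathcal F$. Ferrers diagram codes: $\mathbb F_q^{\mathcal F}$ is the space of $n\times n$ matrices over $\mathbb F_q$ whose entries outside the positions in $\mathcal F$ are zero. An $[\mathcal F,k,d]_q$ Ferrers diagram rank-metric code is a $k$-dimensional $\mathbb F_q$-linear subspace of $\mathbb F_q^{\mathcal F}$ whose minimum rank over nonzero elements is $d$ (the zero code is regarded as an $[\mathcal F,0,d]_q$ code). Blocks: $Q_{i,j}=Q_{i,j}^{(m)}:=([im]\setminus[(i-1)m])\times([jm]\setminus[(j-1)m])$. A Ferrers diagram $\mathcal F$ of order $sm$ is an $m$-block Ferrers diagram if $Q_{i,j}\cap\mathcal F\in\{\emptyset,Q_{i,j}\}$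 for all $i,j\in[s]$. Its block set is $\mathbf B(\mathcal F)=\{Q_{i,j}: i,j\in[s],\ Q_{i,j}\subseteq\mathcal F\}$. The block diagonals are $D_i^B=\{Q_{l,s-i+l}:1\le l\le i\}$, $i\in[s]$. MSRD codes: on $(\mathbb F_q^{m\times m})^t$ the sum-rank weight of $(X_1,\dots,X_t)$ is $\sum_i\operatorname{rk}(X_i)$. An $[(m\times m)^t,k,d]_q$ code is a $k$-dimensional $\mathbb F_q$-linear subspace whose minimum sum-rank weight over nonzero elements is $d$. It is MSRD if $k=m(tm-d+1)$. Diagonal MSRD construction: assume $q\ge D^B_{\max}+1$. For each $j\in\{\lceil d/m\rceil,\dots,D^B_{\max}\}$ let $A_j\subseteq(\mathbb F_q^{m\times m})^j$ be an $[(m\times m)^j,m(mj-d+1),d]_q$ MSRD code (such codes exist since $j\le q-1$), and let $A_j:=\{0\}$ for $j<\lceil d/m\rceil$. Define $\mathcal C$ as the set of all $C\in\mathbb F_q^{\mathcal F}$ such that, for every $i\in[s]$, the $i$-th block diagonal of $C$ (the tuple of $m\times m$ submatrices of $C$ at the blocks in $D_i^B\cap\mathbf B(\mathcal F)$, ordered from top-left to bottom-right) is a codeword of $A_{|D_i^B\cap\mathbf B(\mathcal F)|}$.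
   Formalization: Codewords are additionally required to vanish on blocks lying on none of the block diagonals D_1,…,D_s; without this the dimension formula fails when F has a block below the main block diagonal (e.g. m=1, s=2, F=[2]², d=1). Otherwise the condition is automatic. *)

(* Defs.v *)
From mathcomp Require Import all_boot all_order all_algebra all_fingroup all_field.

Set Implicit Arguments.
Unset Strict Implicit.
Unset Printing Implicit Defensive.

Import GRing.Theory.
Local Open Scope ring_scope.

(* All index sets [n] = {1, ..., n} are represented by 'I_n = {0, ..., n-1};
   every index below is therefore one less than its usual value. *)

Section Diagrams.

Definition ferrers n (F : {set 'I_n * 'I_n}) : Prop :=
  (forall i j j' : 'I_n, (i, j) \in F -> j' = j.+1 :> nat -> (i, j') \in F) /\
  (forall i i' j : 'I_n, (i, j) \in F -> i = i'.+1 :> nat -> (i', j) \in F).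

Definition blockQ s m (i j : 'I_s) : {set 'I_(s * m) * 'I_(s * m)} :=
  [set p : 'I_(s * m) * 'I_(s * m) |
    (i * m <= p.1 < i.+1 * m)%N && (j * m <= p.2 < j.+1 * m)%N].

Definition block_ferrers s m (F : {set 'I_(s * m) * 'I_(s * m)}) : Prop :=
  ferrers F /\
  forall i j : 'I_s, blockQ m i j :&: F = set0 \/ blockQ m i j :&: F = blockQ m i j.

(* A block is represented by its pair of block coordinates. *)
Definition block_set s m (F : {set 'I_(s * m) * 'I_(s * m)}) : {set 'I_s * 'I_s} :=
  [set b : 'I_s * 'I_s | blockQ m b.1 b.2 \subset F].

(* With i = i0 + 1 and l = l0 + 1, the block Q_{l, s-i+l} (1 <= l <= i) has
   0-based coordinates (l0, s - (i0 + 1) + l0), where l0 <= i0. *)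
Definition block_diag s (i : 'I_s) : {set 'I_s * 'I_s} :=
  [set b : 'I_s * 'I_s | (b.1 <= i)%N && (b.2 == s - i.+1 + b.1 :> nat)%N].

Definition diag_in s m (F : {set 'I_(s * m) * 'I_(s * m)}) (i : 'I_s) :
    {set 'I_s * 'I_s} := block_diag i :&: block_set F.

Definition diag_max s m (F : {set 'I_(s * m) * 'I_(s * m)}) : nat :=
  (\max_(i < s) #|diag_in F i|)%N.

Lemma block_index_subproof s m (i : 'I_s) (a : 'I_m) : (i * m + a < s * m)%N.
Proof.
apply: (@leq_trans (i.+1 * m)); last by rewrite leq_mul2r ltn_ord orbT.
by rewrite mulSn addnC ltn_add2r.
Qed.

Definition block_index s m (i : 'I_s) (a : 'I_m) : 'I_(s * m) :=
  Ordinal (block_index_subproof i a).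

End Diagrams.

Section Codes.

Variable K : finFieldType.

Definition ferrers_supported n (F : {set 'I_n * 'I_n}) (M : 'M[K]_n) : Prop :=
  forall i j : 'I_n, (i, j) \notin F -> M i j = 0.

(* [w] attains its minimum over the nonzero vectors of [C], and it is [d];
   in particular [C] is nonzero. *)
Definition min_weight (V : vectType K) (w : V -> nat) (C : {vspace V}) (d : nat) : Prop :=
  (exists2 x, x \in C & x != 0 /\ w x = d) /\
  (forall x, x \in C -> x != 0 -> (d <= w x)%N).

(* The zero code counts as having every minimum distance. *)
Definition ferrers_code n (F : {set 'I_n * 'I_n}) (k d : nat)
    (C : {vspace 'M[K]_n}) : Prop :=
  [/\ forall M, M \in C -> ferrers_supported F M,
      \dim C = k
    & C = 0%VS \/ min_weight (fun M : 'M[K]_n => \rank M) C d].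

Definition sum_rank m t (X : {ffun 'I_t -> 'M[K]_m}) : nat := (\sum_(i < t) \rank (X i))%N.

Definition sum_rank_code m t (k d : nat)
    (A : {vspace {ffun 'I_t -> 'M[K]_m}}) : Prop :=
  \dim A = k /\ min_weight (@sum_rank m t) A d.

(* Adding 1 before subtracting d makes the natural subtraction exact: an
   [(m x m)^t, k, d] code has d <= t * m. *)
Definition msrd m t (d : nat) (A : {vspace {ffun 'I_t -> 'M[K]_m}}) : Prop :=
  sum_rank_code (m * (t * m + 1 - d)) d A.

Definition ceil_div (d m : nat) : nat := (d %/ m + ~~ (m %| d))%N.

Definition msrd_family m (d D : nat)
    (A : forall j : nat, {vspace {ffun 'I_j -> 'M[K]_m}}) : Prop :=
  (forall j, (ceil_div d m <= j <= D)%N -> msrd d (A j)) /\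
  (forall j, (j < ceil_div d m)%N -> A j = 0%VS).

Variables (s m : nat).

Definition block_of (M : 'M[K]_(s * m)) (b : 'I_s * 'I_s) : 'M[K]_m :=
  \matrix_(a, c) M (block_index b.1 a) (block_index b.2 c).

(* [enum_val] enumerates pairs by increasing first component, so the blocks
   come from top-left to bottom-right. *)
Definition diag_tuple (F : {set 'I_(s * m) * 'I_(s * m)}) (M : 'M[K]_(s * m))
    (i : 'I_s) : {ffun 'I_#|diag_in F i| -> 'M[K]_m} :=
  [ffun t => block_of M (enum_val t)].

(* The codewords are zero outside the s block diagonals. This is automatic when
   the diagram has no block strictly below the main block diagonal; otherwise
   such blocks would carry arbitrary entries. *)
Definition diag_codeword (F : {set 'I_(s * m) * 'I_(s * m)})
    (A : forall j : nat, {vspace {ffun 'I_j -> 'M[K]_m}}) (M : 'M[K]_(s * m)) : Prop :=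
  [/\ ferrers_supported F M,
      forall b : 'I_s * 'I_s, b \notin \bigcup_(i < s) block_diag i -> block_of M b = 0
    & forall i : 'I_s, diag_tuple F M i \in A #|diag_in F i|].

End Codes.

(* Main.v *)
From HB Require Import structures.
Require Import Defs.
From mathcomp Require Import all_boot all_order all_algebra all_fingroup all_field.
From mathcomp Require Import ring zify.

(** Existence of the MSRD codes.  Let q be the order of K, let L be the extension
    of K of degree m, with Frobenius map sigma, and let a_1, ..., a_t in L be
    nonzero elements with pairwise distinct norms to K; such elements exist as
    long as t <= q - 1.  A skew polynomial f = sum_h f_h X^h over L acts on L
    through each a_i by letting X act as the K-linear map y |-> a_i sigma(y), and
    sending f to the t-tuple of K-matrices of these actions defines a linearized
    Reed-Solomon code.  A skew polynomial of degree n has kernels whose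
    dimensions add up to at most n ([dim_lker_skew_eval]): a nonzero y killed
    through a_i lets one divide f on the right by the linear factor
    X - a_i sigma(y)/y, and this factor kills only the line K y through a_i and
    nothing through the other a_j, because a_i sigma(y)/y determines the norm of
    a_i.  So the polynomials with k = t m - d + 1 coefficients give a code of
    dimension m k all of whose nonzero words have sum-rank weight at least d,
    and the Singleton bound ([singleton_bound]) provides a word of weight
    exactly d.

    The diagonal construction.  The block diagonals of F are disjoint, so the
    code is the direct sum of copies of the codes chosen on the diagonals, which
    gives its dimension.  If M is a nonzero codeword, take the lowest diagonal
    on which M does not vanish.  All blocks of M below it are zero, so M is block
    triangular with respect to that diagonal and its rank is at least the
    sum of the ranks of the blocks there ([mxrank_block_triangular]), that is, at
    least d.  A minimum weight word placed on one diagonal has rank exactly d,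
    by subadditivity of the rank. *)

Set Implicit Arguments.
Unset Strict Implicit.
Unset Printing Implicit Defensive.

Import GRing.Theory passmx.
Local Open Scope ring_scope.

(** * Finite extensions of a finite field *)

(** The extension is the splitting field of P = X^(q^m) - X.  The roots of P are
    the fixed points of the m-th power of the Frobenius automorphism, hence form
    a subfield and exhaust the splitting field; as P is separable there are q^m
    of them.  The nonzero elements of L are the roots of X^(q^m - 1) - 1, so one of
    them is a primitive root of unity. *)
Lemma finite_extension_of_degree (K : finFieldType) (m : nat) : (0 < m)%N ->
  exists (L : fieldExtType K) (sigma : 'AEnd(L)) (g : L),
    [/\ \dim {:L} = m, forall x, sigma x = x ^+ #|K|,
      forall x : L, x ^+ (#|K| ^ m) = x
      & (#|K| ^ m).-1.-primitive_root g].
Proof.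
move=> m_gt0; set q := #|K|; pose n := (q ^ m)%N.
have q_gt1 : (1 < q)%N by apply: finNzRing_gt1.
have n_gt1 : (1 < n)%N by rewrite (ltn_exp2l 0).
have n1_gt0 : (0 < n.-1)%N by rewrite -ltnS prednK // ltnW.
pose P := 'X^n - 'X.
have DP R : P R = ('X^(n.-1) - 1) * ('X - 0).
  by rewrite subr0 mulrBl mul1r -exprSr prednK // ltnW.
have /FinSplittingFieldFor[/= L splitLP]: P K != 0.
  by rewrite DP monic_neq0 ?rpredM ?monicXsubC ?monicXnsubC.
rewrite [map_poly _ _]rmorphB rmorphXn /= map_polyX -/(P L) in splitLP.
have nL0 : n%:R = 0 :> L.
  have qK0 : q%:R = 0 :> K.
    have := @cyclic.expg_cardG K [set: K]%G 1%R (in_setT _).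
    by rewrite FinRing.zmodXgE cardsT.
  by rewrite natrX -(rmorph_nat (in_alg L)) qK0 rmorph0 expr0n gtn_eqF.
have /finField_galois_generator[/= a _ Da]: (1 <= {:L})%VS by apply: sub1v.
rewrite dimv1 expn1 -/q in Da.
have{splitLP} [zs DPL defL] := splitLP.
(* The factor X^(n - 1) - 1 is separable because n - 1 = -1 in L. *)
have Uzs: uniq zs.
  rewrite -separable_prod_XsubC -(eqp_separable DPL) DP separable_root andbC.
  rewrite /root !hornerE subr_eq0 eq_sym expr0n gtn_eqF ?oner_eq0 //=.
  rewrite cyclotomic.separable_Xn_sub_1 // -subn1 natrB ?(ltnW n_gt1) //.
  by rewrite nL0 sub0r oppr_eq0 oner_eq0.
have in_zs z : (z \in zs) = (z ^+ n == z).
  by rewrite -root_prod_XsubC -(eqp_root DPL) /root !hornerE subr_eq0.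
have fix_n z : (a ^+ m)%g z = z ^+ n.
  rewrite /n; elim: (m) => [|i IHi]; first by rewrite gal_id.
  by rewrite expgSr expnSr exprM galM ?memvf // IHi Da ?memvf.
have zs_all z : z \in zs.
  (* The splitting field is generated by zs, whose elements are fixed. *)
  pose Em := fixedSpace (a ^+ m)%g.
  suffices defEm: Em = {:L}%VS.
    have /fixedSpaceP : z \in Em by rewrite defEm memvf.
    by rewrite in_zs fix_n => ->.
  apply/eqP; rewrite eqEsubv subvf -defL -[Em]subfield_closed agenvS //.
  rewrite subv_add sub1v; apply/span_subvP=> y; rewrite in_zs => /eqP zsy.
  by apply/fixedSpaceP; rewrite fix_n.
have size_zs : size zs = n.
  apply: succn_inj; rewrite -(size_prod_XsubC _ id).
  by rewrite -(eqp_size DPL) size_polyDl size_polyXn // size_polyN size_polyX.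
(* The n - 1 nonzero elements are (n - 1)-th roots of unity. *)
have : has n.-1.-primitive_root (rem 0 zs).
  apply: cyclic.has_prim_root => //; last 2 first.
  - exact: rem_uniq.
  - by rewrite size_rem ?zs_all // size_zs.
  apply/allP=> z; rewrite mem_rem_uniq // inE => /andP[nz_z].
  rewrite in_zs unity_rootE -{1}[n]prednK ?(ltnW n_gt1) // exprS => /eqP zn.
  by apply/eqP/(mulfI nz_z); rewrite mulr1.
case/hasP=> g _ g_prim; exists L, (gal_repr a), g; split=> // [|x|x].
- apply: (@expnI q) => //; rewrite -/n -size_zs.
  pose L' := FinFieldExtType L.
  rewrite -(@card_vspace K L' (Vector.on L) fullv) -((@card_uniqP L' zs) Uzs).
  by apply: eq_card => x; rewrite memvf; apply/esym/zs_all.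
- by rewrite -Da ?memvf.
- by apply/eqP; rewrite -in_zs.
Qed.

(** * Kernels of skew polynomials *)

Lemma dim_lker_comp (K : fieldType) (U V W : vectType K)
    (f : 'Hom(U, V)) (g : 'Hom(V, W)) :
  (\dim (lker (g \o f)%VF) <= \dim (lker f) + \dim (lker g))%N.
Proof.
rewrite -(limg_ker_dim f) leq_add ?dimvS ?capvSr //.
by apply/subvP=> _ /memv_imgP[x + ->]; rewrite !memv_ker comp_lfunE.
Qed.

Section SkewPolynomials.

Variables (K : fieldType) (L : fieldExtType K) (sigma : 'AEnd(L)).

(** The action on L of the variable X of the skew polynomial ring L[X; sigma],
    in which X c = sigma(c) X, attached to the point a. *)
Definition twist (a : L) : 'End(L) := (amull a \o sigma)%VF.

(** The action at a of the skew polynomial with the n coefficients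
    f 0, ..., f (n - 1).  Being built from K-linear maps only, it has a kernel and
    a matrix over K. *)
Definition skew_eval (n : nat) (f : nat -> L) (a : L) : 'End(L) :=
  \sum_(h < n) (amull (f h) \o iter h (comp_lfun (twist a)) \1)%VF.

Lemma twistE a x : twist a x = a * sigma x.
Proof. by rewrite comp_lfunE lfunE. Qed.

Lemma skew_evalE n f a x :
  skew_eval n f a x = \sum_(h < n) f h * iter h (twist a) x.
Proof.
rewrite sum_lfunE; apply: eq_bigr => h _; rewrite comp_lfunE lfunE /=.
congr (_ * _); elim: (h : nat) => [|k IHk] /=; first by rewrite id_lfunE.
by rewrite comp_lfunE IHk.
Qed.

Lemma iter_twistM h a c x :
  iter h (twist a) (c * x) = iter h sigma c * iter h (twist a) x.
Proof. by elim: h => //= h ->; rewrite !twistE rmorphM mulrCA. Qed.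

Lemma iter_twistB h a x y :
  iter h (twist a) (x - y) = iter h (twist a) x - iter h (twist a) y.
Proof. by elim: h => //= h ->; rewrite linearB. Qed.

(** Right division by X - c in L[X; sigma]; the quotient and the remainder do not
    depend on the point a.  The leading term f_{n+1} X^{n+1} equals
    f_{n+1} X^n (X - c) + f_{n+1} sigma^n(c) X^n, whose second part is absorbed
    into the coefficient of X^n.  The clause on leading coefficients keeps the
    quotient nonzero in later inductions. *)
Lemma skew_division n (f : nat -> L) c :
  exists (g : nat -> L) (r : L),
    ((0 < n)%N -> g n.-1 = f n) /\
    forall a x, skew_eval n.+1 f a x
                = skew_eval n g a (twist a x - c * x) + r * x.
Proof.
elim: n f => [|n IHn] f.
  exists f, (f 0%N); split=> // a x.
  by rewrite !skew_evalE big_ord0 big_ord_recl big_ord0 add0r addr0.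
pose f' h := if h == n then f n + f n.+1 * iter n sigma c else f h.
have [g [r [_ gP]]] := IHn f'.
exists (fun h => if h == n then f n.+1 else g h), r.
split=> [_|a x]; first by rewrite eqxx.
(* Only the coefficients of index n differ between f' and f, and between the
   new quotient and g. *)
have low (u v : nat -> L) y : (forall h, (h < n)%N -> u h = v h) ->
    \sum_(h < n) u h * iter h (twist a) y = \sum_(h < n) v h * iter h (twist a) y.
  by move=> uv; apply: eq_bigr => h _; rewrite uv.
have ltn_neq h : (h < n)%N -> (h == n) = false by move=> ?; rewrite ltn_eqF.
have := gP a x; rewrite !skew_evalE !big_ord_recr /= eqxx.
rewrite (low f' f) => [|h /ltn_neq hn]; last by rewrite /f' hn.
rewrite (low (fun h => if h == n then f n.+1 else g h) g) => [|h /ltn_neq -> //].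
set S := \sum_(h < n) _; set T := \sum_(h < n) _.
rewrite /f' eqxx iter_twistB iter_twistM -iterSr iterS.
by move/esym/(canRL (addrK _)) => ->; ring.
Qed.

Variables (I : finType) (a : I -> L).
Hypothesis fix_sigma : forall x, sigma x = x -> x \in 1%VS.
Hypothesis a_neq0 : forall i, a i != 0.
(** Non-conjugacy of the points: they lie in distinct cosets of the group formed by
    the quotients sigma(z) / z. *)
Hypothesis a_nonconj : forall i j y z, y != 0 -> z != 0 ->
  a i * (sigma y / y) = a j * (sigma z / z) -> i = j.

(** If a_i sigma(z) = a_{i0} (sigma(y)/y) z with z nonzero, then i = i0 by
    non-conjugacy, and z/y is fixed by sigma, so z lies on the line K y. *)
Lemma dim_lker_linear_factor (i0 : I) (y : L) : y != 0 ->
  (\sum_i \dim (lker (twist (a i) - amull (a i0 * (sigma y / y)))%R) <= 1)%N.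
Proof.
move=> nz_y; rewrite (bigD1 i0) //= big1 => [|i ne_i].
  rewrite addn0; have -> : 1%N = \dim <[y]> by rewrite dim_vline nz_y.
  apply/dimvS/subvP=> z; rewrite memv_ker add_lfunE opp_lfunE twistE [amull _ _]lfunE /=.
  rewrite subr_eq0 -mulrA => /eqP/(mulfI (a_neq0 i0)) zP.
  have /fix_sigma/vlineP[k zk] : sigma (z / y) = z / y.
    have -> : sigma (z / y) = sigma z / sigma y by exact: fmorph_div.
    by rewrite zP [_ * z]mulrAC -[_ / y]mulrA [sigma y * _]mulrC mulfK // fmorph_eq0.
  by apply/vlineP; exists k; rewrite -(divfK nz_y z) zk mulr_algl.
apply/eqP; rewrite dimv_eq0 -subv0.
apply/subvP=> z; rewrite memv_ker memv0 add_lfunE opp_lfunE twistE [amull _ _]lfunE /=.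
rewrite subr_eq0 => /eqP zP.
apply: contraR ne_i => nz_z; apply/eqP/(a_nonconj nz_z nz_y).
by apply/(mulIf nz_z); rewrite -mulrA divfK.
Qed.

(** The analogue for skew polynomials of the bound of the number of roots of a
    polynomial by its degree. *)
Lemma dim_lker_skew_eval n (f : nat -> L) : f n != 0 ->
  (\sum_i \dim (lker (skew_eval n.+1 f (a i))) <= n)%N.
Proof.
elim: n f => [|n IHn] f nz_f.
  rewrite big1 // => i _; apply/eqP; rewrite dimv_eq0 -subv0.
  apply/subvP=> z; rewrite memv_ker memv0 skew_evalE big_ord_recl big_ord0 addr0.
  by rewrite mulf_eq0 (negPf nz_f).
have [/forallP ker0|] := boolP [forall i, \dim (lker (skew_eval n.+2 f (a i))) == 0%N].
  by rewrite big1 // => i _; apply/eqP.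
case/forallPn=> i0; rewrite dimv_eq0 => nz_ker.
pose y := vpick (lker (skew_eval n.+2 f (a i0))).
have nz_y : y != 0 by rewrite vpick0.
have yP : skew_eval n.+2 f (a i0) y = 0 by apply/eqP; rewrite -memv_ker memv_pick.
have [g [r [/(_ isT) gn gP]]] := skew_division n.+1 f (a i0 * (sigma y / y)).
have r0 : r = 0.
  have := gP (a i0) y; rewrite yP twistE -mulrA divfK // subrr linear0 add0r.
  by move/esym/eqP; rewrite mulf_eq0 (negPf nz_y) orbF => /eqP.
have facto b : skew_eval n.+2 f b
    = (skew_eval n.+1 g b \o (twist b - amull (a i0 * (sigma y / y)))%R)%VF.
  apply/lfunP=> x; rewrite gP r0 mul0r addr0 comp_lfunE.
  by rewrite add_lfunE opp_lfunE [amull _ _]lfunE.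
apply: leq_trans (_ : 1 + n <= _)%N => //.
apply: leq_trans (leq_add (dim_lker_linear_factor i0 nz_y) (IHn g _)); last by rewrite gn.
by rewrite -big_split; apply: leq_sum => i _; rewrite facto dim_lker_comp.
Qed.

End SkewPolynomials.

(** * The Singleton bound for the sum-rank metric *)

Lemma mxrank_sum_le (K : fieldType) m n (I : Type) (r : seq I) (P : pred I)
    (X : I -> 'M[K]_(m, n)) :
  (\rank (\sum_(i <- r | P i) X i)%R <= \sum_(i <- r | P i) \rank (X i))%N.
Proof.
apply: (big_ind2 (fun Y k => \rank Y <= k)%N) => // [|Y1 k1 Y2 k2 le1 le2].
  by rewrite mxrank0.
exact: leq_trans (mxrank_add _ _) (leq_add le1 le2).
Qed.

Lemma mxrank_le_nz_rows (K : fieldType) m n (X : 'M[K]_(m, n)) :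
  (\rank X <= \sum_(i < m) (row i X != 0%R))%N.
Proof.
have {1}-> : X = \sum_i delta_mx i 0 *m row i X.
  apply/matrixP=> i j; rewrite summxE (bigD1 i) //= big1 => [|i' ne_i'].
    by rewrite addr0 mxE big_ord1 !mxE !eqxx mul1r.
  by rewrite mxE big_ord1 !mxE [i == i']eq_sym (negPf ne_i') mul0r.
apply: leq_trans (mxrank_sum_le _ _ _) _; apply: leq_sum => i _.
have [->|_] := eqVneq (row i X) 0; first by rewrite mulmx0 mxrank0.
exact: leq_trans (mxrankM_maxr _ _) (rank_leq_row _).
Qed.

Section Singleton.
Variables (K : finFieldType) (t m : nat) (B : {set 'I_t * 'I_m}).

(** The pairs in B are a block together with a row of that block; they index the
    rows that are kept. *)
Definition puncture (X : {ffun 'I_t -> 'M[K]_m}) : 'M[K]_(#|B|, m) :=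
  \matrix_(u, c) X (enum_val u).1 (enum_val u).2 c.

Fact puncture_is_linear : linear puncture.
Proof. by move=> k X Y; apply/matrixP=> u c; rewrite !mxE !ffunE !mxE. Qed.

HB.instance Definition _ := GRing.isLinear.Build K _ _ _ puncture puncture_is_linear.

(** The rank of each block is at most the number of its nonzero rows, all of which
    are indexed outside B. *)
Lemma puncture0_sum_rank X : puncture X = 0 -> (sum_rank X <= t * m - #|B|)%N.
Proof.
move=> X0; apply: leq_trans (leq_sum _ (fun i _ => mxrank_le_nz_rows (X i))) _.
have -> : (t * m - #|B|)%N = #|~: B| by rewrite [RHS]cardsCs setCK card_prod !card_ord.
rewrite pair_big /= -sum1_card [X in (_ <= X)%N]big_mkcond.
apply: leq_sum => -[i l] _; rewrite inE /=.
case: (boolP ((i, l) \in B)) => //= ilB; last by rewrite leq_b1.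
rewrite leqn0 eqb0 negbK; apply/eqP/rowP=> c.
have /matrixP/(_ (enum_rank_in ilB (i, l)) c) := X0.
by rewrite !mxE enum_rankK_in.
Qed.

End Singleton.

(** Keeping only t m - d rows maps A to a space of dimension m (t m - d), which is
    too small for the map to be injective; a word in its kernel has at most d
    nonzero rows. *)
Lemma singleton_bound (K : finFieldType) t m d (A : {vspace {ffun 'I_t -> 'M[K]_m}}) :
  (d <= t * m)%N -> (m * (t * m - d) < \dim A)%N ->
  exists2 X, X \in A & X != 0 /\ (sum_rank X <= d)%N.
Proof.
move=> d_le dimA.
pose s := take (t * m - d) (enum {: 'I_t * 'I_m}); pose B := [set p in s].
have cardB : #|B| = (t * m - d)%N.
  rewrite cardsE (card_uniqP _) ?take_uniq ?enum_uniq // size_takel //.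
  by rewrite -cardE card_prod !card_ord leq_subr.
pose rho := linfun (@puncture K t m B).
have : (A :&: lker rho)%VS != 0%VS.
  apply: contraL dimA => /eqP cap0; rewrite -leqNgt -(limg_dim_eq cap0).
  apply: leq_trans (dimvS (subvf _)) _.
  by rewrite dimvf dim_matrix cardB; apply: eq_leq (mulnC _ _).
rewrite -vpick0; set X := vpick _ => nz_X.
have := memv_pick (A :&: lker rho)%VS.
rewrite -/X memv_cap memv_ker lfunE => /andP[XA /eqP X0].
exists X => //; split=> //; apply: leq_trans (puncture0_sum_rank X0) _.
by rewrite cardB subKn.
Qed.

(** * Linearized Reed-Solomon codes *)

(** In coordinates every value of phi is a combination of the rows of its matrix. *)
Lemma dim_limg_mxof (K : fieldType) (V : vectType K)
    (e : (\dim {:V}).-tuple V) (phi : 'End(V)) :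
  basis_of {:V} e -> (\dim (limg phi) <= \rank (mxof e e phi))%N.
Proof.
move=> e_basis; set M := mxof e e phi.
pose rho := linfun (vecof e \o mulmxr (row_base M)).
have : (limg phi <= limg rho)%VS.
  apply/subvP=> _ /memv_imgP[x _ ->]; apply/memv_imgP.
  have /submxP[u uE] : (rVof e x *m M <= row_base M)%MS by rewrite eq_row_base submxMl.
  exists u; first exact: memvf.
  by rewrite lfunE /= -uE mul_mxof !rVofK.
move/dimvS/leq_trans; apply; apply: leq_trans (_ : \dim {:'rV[K]_(\rank M)} <= _)%N.
  by rewrite -(limg_ker_dim rho fullv) leq_addl.
by rewrite dimvf dim_matrix; apply: eq_leq (mul1n _).
Qed.

Section LinearizedReedSolomon.

Variables (K : finFieldType) (L : fieldExtType K) (sigma : 'AEnd(L)).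
Local Notation m := (\dim {:L}).
Local Notation mx := (mxof (vbasis {:L}) (vbasis {:L})).

(** Coefficient vectors of length k range over a finite-dimensional K-space, as
    the domain of a linear encoder must; [skew_eval] reads them as sequences. *)
Definition coeff k (f : {ffun 'I_k -> L}) (h : nat) : L := oapp f 0 (insub h).

Lemma coeffE k (f : {ffun 'I_k -> L}) (h : 'I_k) : coeff f h = f h.
Proof. by rewrite /coeff valK. Qed.

Definition lrs t k (a : 'I_t -> L) (f : {ffun 'I_k -> L}) : {ffun 'I_t -> 'M[K]_m} :=
  [ffun i => mx (skew_eval sigma k (coeff f) (a i))].

Fact lrs_is_linear t k a : linear (@lrs t k a).
Proof.
move=> c f g; apply/ffunP=> i; rewrite !ffunE -linearP; congr (mx _).
apply/lfunP=> x; rewrite add_lfunE scale_lfunE !skew_evalE scaler_sumr -big_split.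
apply: eq_bigr => h _; rewrite /= !coeffE !ffunE.
by rewrite mulrDl scalerAl.
Qed.

HB.instance Definition _ t k a :=
  GRing.isLinear.Build K _ _ _ (@lrs t k a) (@lrs_is_linear t k a).

Variables (t : nat) (a : 'I_t -> L).
Hypothesis fix_sigma : forall x, sigma x = x -> x \in 1%VS.
Hypothesis a_neq0 : forall i, a i != 0.
Hypothesis a_nonconj : forall i j (y z : L), y != 0 -> z != 0 ->
  a i * (sigma y / y) = a j * (sigma z / z) -> i = j.

(** The zero count is applied at the largest index n < k of a nonzero coefficient,
    which is the true degree of f. *)
Lemma dim_lker_lrs k (f : {ffun 'I_k -> L}) : f != 0 ->
  (\sum_i \dim (lker (skew_eval sigma k (coeff f) (a i))) < k)%N.
Proof.
move=> nz_f.
have [h nz_h] : exists h, f h != 0.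
  apply/existsP; apply: contraR nz_f => /existsPn f0; apply/eqP/ffunP=> h.
  by rewrite ffunE; apply/eqP; rewrite -[_ == _]negbK.
case: (@arg_maxnP _ h (fun h => f h != 0) val nz_h) => n nz_n n_max.
have trunc i : skew_eval sigma k (coeff f) (a i)
    = skew_eval sigma n.+1 (coeff f) (a i).
  pose F h := (amull (coeff f h) \o iter h (comp_lfun (twist sigma (a i))) \1)%VF.
  rewrite /skew_eval (big_ord_widen k F (ltn_ord n)) [RHS]big_mkcond.
  apply: eq_bigr => l _; case: ltnP => // lt_nl; rewrite coeffE.
  have -> : f l = 0 by apply: contraTeq lt_nl => /n_max; rewrite -ltnNge.
  by apply/lfunP=> x; rewrite comp_lfunE !lfunE /= mul0r.
under eq_bigr do rewrite trunc.
apply: leq_ltn_trans (dim_lker_skew_eval fix_sigma a_neq0 a_nonconj _) (ltn_ord n).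
by rewrite coeffE.
Qed.

(** In each of the t blocks the rank is m minus the dimension of the kernel. *)
Lemma lrs_sum_rank k (f : {ffun 'I_k -> L}) : f != 0 ->
  (t * m + 1 <= sum_rank (lrs a f) + k)%N.
Proof.
move=> nz_f; apply: leq_trans (leq_add (leqnn _) (dim_lker_lrs nz_f)).
rewrite addn1 addnS ltnS /sum_rank -big_split /=.
rewrite -[X in (X * _)%N]card_ord -sum_nat_const; apply: leq_sum => i _.
rewrite ffunE -[X in (X <= _)%N](limg_ker_dim (skew_eval sigma k (coeff f) (a i))) capfv addnC.
by rewrite leq_add2r dim_limg_mxof // vbasisP.
Qed.

(** The weight bound makes the encoder injective, because 0 < d, so the dimension is
    m k; this exceeds m (t m - d) by m, and the Singleton bound yields a word of
    weight d. *)
Lemma lrs_msrd d : (0 < d <= t * m)%N ->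
  msrd d (limg (linfun (@lrs t (t * m + 1 - d) a))).
Proof.
case/andP=> d_gt0 d_le; set k := (_ - d)%N; set C := limg _.
have dk : (t * m + 1 = d + k)%N by rewrite subnKC // addn1 leqW.
have wtC (f : {ffun 'I_k -> L}) : f != 0 -> (d <= sum_rank (lrs a f))%N.
  by move=> nz_f; have := lrs_sum_rank nz_f; rewrite dk leq_add2r.
have dimC : \dim C = (m * k)%N.
  rewrite limg_dim_eq.
    by rewrite !dimvf mulnC -[in RHS](card_ord k).
  apply/eqP; rewrite -subv0; apply/subvP=> f; rewrite memv_cap memv_ker lfunE /= memv0.
  case/andP=> _; apply: contraLR => /wtC.
  apply: contraTneq => ->; rewrite -ltnNge /sum_rank big1 // => i _.
  by rewrite ffunE mxrank0.
have minC X : X \in C -> X != 0 -> (d <= sum_rank X)%N.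
  case/memv_imgP=> f _ ->; rewrite lfunE /= => nz_X; apply: wtC.
  by apply: contraNneq nz_X => ->; rewrite linear0.
split=> //; split=> //.
have m_gt0 : (0 < m)%N by lia.
have [|X XC [nz_X wtX]] := @singleton_bound K t m d C d_le.
  by rewrite dimC ltn_pmul2l // /k; lia.
by exists X => //; split=> //; apply/eqP; rewrite eqn_leq wtX minC.
Qed.

End LinearizedReedSolomon.

(** The norm x |-> x^N with N = 1 + q + ... + q^(m-1) sends y^q / y = y^(q-1) to 1,
    so that a common value forces g^i and g^j to have the same norm.  As g has order
    (q - 1) N, the norms of the first q - 1 powers of g are distinct. *)
Lemma prim_root_powers_nonconj (L : fieldType) (q m : nat) (g : L) :
  (1 < q)%N -> (0 < m)%N -> (q ^ m).-1.-primitive_root g ->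
  (forall x : L, x ^+ (q ^ m) = x) ->
  forall (i j : nat) (y z : L), (i < q.-1)%N -> (j < q.-1)%N ->
    y != 0 -> z != 0 ->
    g ^+ i * (y ^+ q / y) = g ^+ j * (z ^+ q / z) -> i = j.
Proof.
move=> q_gt1 m_gt0 g_prim expL i j y z lt_i lt_j nz_y nz_z.
pose N := (\sum_(e < m) q ^ e)%N.
have qN : (q.-1 * N)%N = (q ^ m).-1 by rewrite predn_exp.
have N_gt0 : (0 < N)%N.
  by rewrite lt0n; apply: contraTneq (prim_order_gt0 g_prim) => N0; rewrite -qN N0 muln0.
have q1E (x : L) : x != 0 -> x ^+ q / x = x ^+ q.-1.
  by move=> nz_x; rewrite -{1}(prednK (ltnW q_gt1)) exprSr mulfK.
have qNE (x : L) : x != 0 -> (x ^+ q.-1) ^+ N = 1.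
  move=> nz_x; rewrite -exprM qN; apply: (mulIf nz_x).
  by rewrite -exprSr prednK ?expL ?mul1r // expn_gt0 ltnW.
rewrite !q1E // => /(congr1 (fun x => x ^+ N)).
rewrite !exprMn !qNE // !mulr1 -!exprM => /eqP.
rewrite (eq_prim_root_expr g_prim) -qN !modn_small ?ltn_pmul2r //.
by rewrite eqn_pmul2r // => /eqP.
Qed.

Lemma ceil_div_leq (d m j : nat) : (0 < m)%N ->
  (ceil_div d m <= j)%N = (d <= j * m)%N.
Proof.
move=> m_gt0; rewrite /ceil_div; have [/dvdnP[k ->]|ndvd] := boolP (m %| d)%N.
  by rewrite addn0 mulnK // leq_pmul2r.
rewrite addn1 ltn_divLR // ltn_neqAle andb_idl // => _.
by apply: contraNneq ndvd => ->; apply: dvdn_mull.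
Qed.

Lemma msrd_family_exists (K : finFieldType) (m d D : nat) :
  (0 < m)%N -> (0 < d)%N -> (D < #|K|)%N ->
  exists A : (forall j : nat, {vspace {ffun 'I_j -> 'M[K]_m}}), msrd_family d D A.
Proof.
move=> m_gt0 d_gt0 ltDq.
have [L [sigma [g [dimL sigmaE expL g_prim]]]] := finite_extension_of_degree K m_gt0.
subst m.
have q_gt1 : (1 < #|K|)%N by apply: finNzRing_gt1.
have fix_sigma x : sigma x = x -> x \in 1%VS.
  by rewrite sigmaE => xq; rewrite (Fermat's_little_theorem 1%AS) /= dimv1 expn1 xq.
exists (fun j => if (ceil_div d (\dim {:L}) <= j)%N
  then limg (linfun (@lrs K L sigma j (j * \dim {:L} + 1 - d) (fun i => g ^+ i)))
  else 0%VS); split=> j; last by rewrite ltnNge => /negPf->.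
case/andP=> le_j le_jD; rewrite le_j; apply: lrs_msrd => //.
- move=> i; rewrite expf_neq0 //; apply: contraTneq (oner_neq0 L) => g0.
  by rewrite -(prim_expr_order g_prim) g0 expr0n gtn_eqF ?(prim_order_gt0 g_prim) ?eqxx.
- move=> i i' y z nz_y nz_z; rewrite !sigmaE => E; apply/val_inj.
  by apply: (prim_root_powers_nonconj q_gt1 m_gt0 g_prim expL _ _ nz_y nz_z E);
    apply: leq_trans (ltn_ord _) _; lia.
by rewrite d_gt0 -ceil_div_leq.
Qed.

(** * Block matrices *)

(** Index the blocks by the list ls, block (y, x) being formed by the rows r y and
    the columns c x.  By induction from the last block on: the rows of all blocks
    after x vanish on the columns c x, so they lie in the kernel of the
    restriction to these columns, while the image of the restriction has at least
    the rank of the diagonal block x. *)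
Lemma mxrank_block_triangular (K : fieldType) n p k l (I : eqType)
    (r : I -> 'I_k -> 'I_n) (c : I -> 'I_l -> 'I_p) (M : 'M[K]_(n, p)) (ls : seq I) :
  pairwise (fun x y => mxsub (r y) (c x) M == 0) ls ->
  (\sum_(x <- ls) \rank (mxsub (r x) (c x) M) <= \rank M)%N.
Proof.
move=> tri; apply: (@leq_trans (\rank (\sum_(x <- ls) <<rowsub (r x) M>>)%MS)); last first.
  apply: mxrankS; elim/big_ind: _ => [|A B sA sB|x _]; first exact: sub0mx.
    by rewrite addsmx_sub sA.
  by rewrite genmxE rowsub_sub.
elim: ls tri => [|x ls IHls] /=; first by rewrite !big_nil.
case/andP=> /allP tri_x /IHls{IHls}; rewrite !big_cons.
set S := (\sum_(y <- ls) _)%MS => leS.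
(* Right multiplication by P restricts a row to the columns c x. *)
pose P : 'M[K]_(p, l) := colsub (c x) 1%:M.
have MP y : rowsub (r y) M *m P = mxsub (r y) (c x) M.
  by rewrite mul_rowsub_mx mulmx_colsub mulmx1 -mxsubrc.
have SP0 : (S <= kermx P)%MS.
  rewrite /S big_seq; elim/big_ind: _ => [|A B sA sB|y /tri_x/eqP xy0].
  - exact: sub0mx.
  - by rewrite addsmx_sub sA.
  - by rewrite genmxE; apply/sub_kermxP; rewrite MP.
rewrite -(mxrank_mul_ker (_ + S)%MS P) leq_add //.
  by rewrite -MP; apply/mxrankS/submxMr/(submx_trans _ (addsmxSl _ _)); rewrite genmxE.
by apply: leq_trans leS (mxrankS _); rewrite sub_capmx addsmxSr.
Qed.

Section Blocks.

Variables (K : finFieldType) (s m : nat).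
Implicit Types (b : 'I_s * 'I_s) (X : 'M[K]_m) (M N : 'M[K]_(s * m)).

Lemma block_index_eq (i j : 'I_s) (a c : 'I_m) :
  (block_index i a == block_index j c) = (i == j) && (a == c).
Proof.
apply/eqP/andP=> [[E]|[/eqP-> /eqP->]] //.
have m_gt0 : (0 < m)%N by apply: leq_trans (ltn_ord a).
have ij : i = j.
  apply/val_inj; have := congr1 (divn^~ m) E.
  by rewrite /= !divnMDl // !divn_small // !addn0.
by split; apply/eqP => //; apply/val_inj; move: E; rewrite ij => /addnI.
Qed.

Lemma block_index_surj (u : 'I_(s * m)) : exists i a, u = block_index i a.
Proof.
have m_gt0 : (0 < m)%N by case: (posnP m) u => // -> [u]; rewrite muln0.
have lt_i : (u %/ m < s)%N by rewrite ltn_divLR.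
by exists (Ordinal lt_i), (Ordinal (ltn_pmod u m_gt0)); apply/val_inj/divn_eq.
Qed.

Lemma block_of_inj M N : (forall b, block_of M b = block_of N b) -> M = N.
Proof.
move=> eqMN; apply/matrixP=> u v.
have [i [a ->]] := block_index_surj u; have [j [c ->]] := block_index_surj v.
by have /matrixP/(_ a c) := eqMN (i, j); rewrite !mxE.
Qed.

Lemma block_of_sum (I : Type) (ls : seq I) (P : pred I) (Ms : I -> 'M[K]_(s * m)) b :
  block_of (\sum_(i <- ls | P i) Ms i) b = \sum_(i <- ls | P i) block_of (Ms i) b.
Proof.
by apply/matrixP=> a c; rewrite mxE !summxE; apply: eq_bigr => i _; rewrite mxE.
Qed.

(** Left multiplication by [block_row i] selects the i-th band of m rows, and its
    transpose inserts m rows there. *)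
Definition block_row (i : 'I_s) : 'M[K]_(m, s * m) := rowsub (block_index i) 1%:M.

Definition put_block b X : 'M[K]_(s * m) := (block_row b.1)^T *m X *m block_row b.2.

Lemma block_row_mul (i j : 'I_s) : block_row i *m (block_row j)^T = (i == j)%:R%:M.
Proof.
apply/matrixP=> a c; rewrite !mxE (bigD1 (block_index i a)) //= big1 => [|u ne_u].
  rewrite !mxE eqxx mul1r addr0 block_index_eq eq_sym [a == c]eq_sym.
  by case: eqP; case: eqP.
by rewrite !mxE eq_sym (negPf ne_u) mul0r.
Qed.

Lemma block_ofE M b : block_of M b = block_row b.1 *m M *m (block_row b.2)^T.
Proof.
rewrite /block_row mul_rowsub_mx mul1mx trmx_mxsub trmx1 mulmx_colsub mulmx1.
by apply/matrixP=> a c; rewrite !mxE.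
Qed.

Lemma block_of_put b b' X : block_of (put_block b X) b' = (b == b')%:R *: X.
Proof.
rewrite block_ofE /put_block !mulmxA block_row_mul mul_scalar_mx -mulmxA.
rewrite block_row_mul mul_mx_scalar scalerA -natrM mulnb andbC.
by rewrite [b'.1 == _]eq_sym -xpair_eqE -!surjective_pairing.
Qed.

Fact put_block_is_linear b : linear (put_block b).
Proof.
by move=> k X Y; rewrite /put_block mulmxDr mulmxDl -scalemxAr -scalemxAl.
Qed.

HB.instance Definition _ b := GRing.isLinear.Build K _ _ _ (put_block b)
  (put_block_is_linear b).

Lemma mxrank_put_block b X : (\rank (put_block b X) <= \rank X)%N.
Proof. exact: leq_trans (mxrankM_maxl _ _) (mxrankM_maxr _ _). Qed.

End Blocks.

(** * The diagonal code of a block Ferrers diagram *)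

Section DiagonalCode.

Variables (K : finFieldType) (s m : nat) (F : {set 'I_(s * m) * 'I_(s * m)}).
Hypothesis hF : block_ferrers F.
Implicit Types (b : 'I_s * 'I_s) (M : 'M[K]_(s * m)).

(** Membership in F depends only on the block, since a block is either contained
    in F or disjoint from it. *)
Lemma block_index_mem (i j : 'I_s) (a c : 'I_m) :
  ((block_index i a, block_index j c) \in F) = ((i, j) \in block_set F).
Proof.
have Qac : (block_index i a, block_index j c) \in blockQ m i j.
  by rewrite inE /= !leq_addr !mulSnr !ltn_add2l !ltn_ord.
rewrite inE; apply/idP/subsetP => [Fac p Qp /=|/(_ _ Qac) //].
have [_ /(_ i j)[Q0|QF]] := hF.
  by have := in_set0 (block_index i a, block_index j c); rewrite -Q0 inE Qac Fac.
by move: Qp; rewrite -QF inE => /andP[].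
Qed.

Lemma ferrers_supportedP M :
  ferrers_supported F M <-> forall b, b \notin block_set F -> block_of M b = 0.
Proof.
split=> [MF [i j] bF|M0 u v].
  by apply/matrixP=> a c; rewrite !mxE MF // block_index_mem.
have [i [a ->]] := block_index_surj u; have [j [c ->]] := block_index_surj v.
by rewrite block_index_mem => /M0/matrixP/(_ a c); rewrite !mxE.
Qed.

Lemma diag_in_inj b i j : b \in diag_in F i -> b \in diag_in F j -> i = j.
Proof.
rewrite !inE => /andP[/andP[_ /eqP bi] _] /andP[/andP[_ /eqP bj] _].
by apply/val_inj; move: (ltn_ord i) (ltn_ord j) => /=; lia.
Qed.

(** The two vanishing conditions on a codeword merge into one: all its blocks off
    the sets [diag_in F i] are zero. *)
Lemma diag_codewordP A M : diag_codeword F A M <->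
  (forall b, (forall i, b \notin diag_in F i) -> block_of M b = 0) /\
  (forall i, diag_tuple F M i \in A #|diag_in F i|).
Proof.
split=> [[/ferrers_supportedP MF Mdiag MA]|[M0 MA]].
  split=> // b bD; have [bF|/MF //] := boolP (b \in block_set F).
  apply: Mdiag; apply/bigcupP=> -[i _ bi].
  by have := bD i; rewrite inE bi bF.
split=> //.
  by apply/ferrers_supportedP=> b bF; apply: M0 => i; rewrite inE negb_and bF orbT.
move=> b bD; apply: M0 => i; rewrite inE negb_and; apply/orP; left.
by apply: contra bD => bi; apply/bigcupP; exists i.
Qed.

Lemma diag_tuple_sum (I : Type) (ls : seq I) (P : pred I) (Ms : I -> 'M[K]_(s * m)) i :
  diag_tuple F (\sum_(j <- ls | P j) Ms j) i = \sum_(j <- ls | P j) diag_tuple F (Ms j) i.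
Proof.
apply/ffunP=> t; rewrite ffunE block_of_sum sum_ffunE.
by apply: eq_bigr => j _; rewrite ffunE.
Qed.

Lemma diag_tuple0 i : diag_tuple F (0 : 'M[K]_(s * m)) i = 0.
Proof. by apply/ffunP=> t; apply/matrixP=> a c; rewrite !ffunE !mxE. Qed.

Definition put_diag i (X : {ffun 'I_#|diag_in F i| -> 'M[K]_m}) : 'M[K]_(s * m) :=
  \sum_t put_block (enum_val t) (X t).

Fact put_diag_is_linear i : linear (@put_diag i).
Proof.
move=> k X Y; rewrite /put_diag scaler_sumr -big_split.
by apply: eq_bigr => t _; rewrite !ffunE linearP.
Qed.

HB.instance Definition _ i := GRing.isLinear.Build K _ _ _ (@put_diag i)
  (@put_diag_is_linear i).

Lemma block_of_put_diag_out i X b : b \notin diag_in F i -> block_of (@put_diag i X) b = 0.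
Proof.
move=> bi; rewrite block_of_sum big1 //= => t _; rewrite block_of_put.
have [E|_] := eqVneq; last by rewrite scale0r.
by rewrite -E enum_valP in bi.
Qed.

Lemma diag_tuple_put_diag i X : diag_tuple F (@put_diag i X) i = X.
Proof.
apply/ffunP=> t; rewrite ffunE block_of_sum (bigD1 t) //= big1 => [|t' ne_t].
  by rewrite block_of_put eqxx scale1r addr0.
by rewrite block_of_put (inj_eq enum_val_inj) (negPf ne_t) scale0r.
Qed.

Lemma diag_tuple_put_diag_out i j X : i != j -> diag_tuple F (@put_diag i X) j = 0.
Proof.
move=> ne_ij; apply/ffunP=> t; rewrite !ffunE block_of_put_diag_out //.
by apply: contra ne_ij => /diag_in_inj/(_ (enum_valP t)) ->.
Qed.

Lemma put_diag_eq0 i X : (@put_diag i X == 0) = (X == 0).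
Proof.
apply/eqP/eqP=> [X0|->]; last exact: linear0.
by rewrite -(diag_tuple_put_diag X) X0 diag_tuple0.
Qed.

Lemma mxrank_put_diag i X : (\rank (@put_diag i X) <= sum_rank X)%N.
Proof.
by apply: leq_trans (mxrank_sum_le _ _ _) _; apply: leq_sum => t _; apply: mxrank_put_block.
Qed.

Lemma sum_put_diag M : (forall b, (forall i, b \notin diag_in F i) -> block_of M b = 0) ->
  M = \sum_i put_diag (diag_tuple F M i).
Proof.
move=> M0; apply: block_of_inj => b; rewrite block_of_sum /=.
have [/existsP[i bi]|/existsPn bD] := boolP [exists i, b \in diag_in F i].
  rewrite (bigD1 i) //= big1 => [|j ne_ji]; last first.
    by rewrite block_of_put_diag_out //; apply: contra ne_ji => /diag_in_inj/(_ bi) ->.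
  have /ffunP/(_ (enum_rank_in bi b)) := diag_tuple_put_diag (diag_tuple F M i).
  by rewrite !ffunE enum_rankK_in // addr0.
by rewrite M0 // big1 // => i _; apply: block_of_put_diag_out.
Qed.

(** The inequality on b says that b lies strictly below the i-th block diagonal. *)
Lemma sum_rank_diag_le M (i : 'I_s) :
  (forall b, (b.2 + i.+1 < s + b.1)%N -> block_of M b = 0) ->
  (sum_rank (diag_tuple F M i) <= \rank M)%N.
Proof.
(* Triangularity needs the blocks in the order of their rows. *)
move=> M0; pose leb b b' := (b.1 <= b'.1)%N.
pose ls := sort leb (enum (diag_in F i)).
have -> : sum_rank (diag_tuple F M i) = (\sum_(b <- ls) \rank (block_of M b))%N.
  rewrite (perm_big (enum (diag_in F i))) /= ?perm_sort // big_enum big_enum_val.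
  by apply: eq_bigr => t _; rewrite ffunE.
have blockE b : block_of M b = mxsub (block_index b.1) (block_index b.2) M by [].
under eq_bigr do rewrite blockE.
apply: mxrank_block_triangular.
have leb_trans : transitive leb by move=> b1 b2 b3; apply: leq_trans.
have leb_total : total leb by move=> b b'; apply: leq_total.
have : pairwise leb ls && uniq ls.
  by rewrite -(sorted_pairwise leb_trans) sort_sorted // sort_uniq enum_uniq.
rewrite uniq_pairwise -pairwise_relI.
apply: (@sub_in_pairwise _ (mem (diag_in F i))); last first.
  by apply/allP=> b; rewrite mem_sort mem_enum.
move=> [b1 b2] [c1 c2] /[!inE] /andP[/andP[_ /= /eqP b2E] _].
move=> /andP[/andP[_ /= /eqP c2E] _].
case/andP=> /= le_bc ne_bc; apply/eqP/(M0 (c1, b2)) => /=.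
have {ne_bc} : b1 != c1 :> nat.
  apply: contraNneq ne_bc => eq_bc; rewrite -pair_eqE /= -!val_eqE /=.
  by rewrite b2E c2E eq_bc !eqxx.
by move: le_bc (ltn_ord i); rewrite /leb /=; lia.
Qed.

Variables (d : nat) (A : forall j : nat, {vspace {ffun 'I_j -> 'M[K]_m}}).

Definition diag_code : {vspace 'M[K]_(s * m)} :=
  (\sum_(i < s) linfun (@put_diag i) @: A #|diag_in F i|)%VS.

Lemma diag_codeP M : M \in diag_code <-> diag_codeword F A M.
Proof.
rewrite diag_codewordP; split=> [/memv_sumP[Ms MsA ->]|[M0 MA]].
  split=> [b bD|i].
    rewrite block_of_sum big1 //= => i _.
    by have /memv_imgP[X _ ->] := MsA i isT; rewrite lfunE /= block_of_put_diag_out.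
  rewrite diag_tuple_sum (bigD1 i) //= big1 => [|j ne_ji].
    have /memv_imgP[X XA ->] := MsA i isT.
    by rewrite lfunE /= diag_tuple_put_diag addr0.
  have /memv_imgP[X _ ->] := MsA j isT.
  by rewrite lfunE /= diag_tuple_put_diag_out.
rewrite (sum_put_diag M0); apply: memv_sumr => i _; apply/memv_imgP.
by exists (diag_tuple F M i); [exact: MA | rewrite lfunE].
Qed.

(** Reading off the i-th diagonal inverts [put_diag] on that diagonal and kills the
    others, so the sum is direct and each embedding is injective. *)
Lemma dim_diag_code : \dim diag_code = (\sum_(i < s) \dim (A #|diag_in F i|))%N.
Proof.
have /directvP -> : directv diag_code.
  apply/directv_sum_independent=> Ms MsA Ms0 i _.
  have /memv_imgP[X _ MsX] := MsA i isT.
  have : diag_tuple F (\sum_i Ms i) i = 0.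
    by rewrite Ms0 diag_tuple0.
  rewrite diag_tuple_sum (bigD1 i) //= big1 ?addr0 => [|j ne_ji].
    by rewrite MsX lfunE /= diag_tuple_put_diag => ->; rewrite linear0.
  have /memv_imgP[Y _ ->] := MsA j isT.
  by rewrite lfunE /= diag_tuple_put_diag_out.
apply: eq_bigr => i _ /=; rewrite limg_dim_eq //; apply/eqP; rewrite -subv0.
by apply/subvP=> X; rewrite memv_cap memv_ker lfunE memv0 /= put_diag_eq0 => /andP[].
Qed.

Hypothesis hA : msrd_family d (diag_max F) A.
Hypothesis m_gt0 : (0 < m)%N.

(** Truncation at zero in the dimension formula matches the components that are
    zero by convention: both occur when a diagonal has fewer than d / m blocks. *)
Lemma diag_component_cases i :
  ((d <= #|diag_in F i| * m)%N /\ msrd d (A #|diag_in F i|)) \/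
  ((#|diag_in F i| * m < d)%N /\ A #|diag_in F i| = 0%VS).
Proof.
have [[Amsrd A0] ltD] := (hA, leq_bigmax i : #|diag_in F i| <= diag_max F)%N.
case: (leqP d (#|diag_in F i| * m)) => le_d; [left|right]; split=> //.
  by apply: Amsrd; rewrite ceil_div_leq // le_d.
by apply: A0; rewrite ltnNge ceil_div_leq // -ltnNge.
Qed.

(** The largest i with a nonzero i-th diagonal is the lowest one, below which M
    vanishes. *)
Lemma diag_code_rank M : M \in diag_code -> M != 0 -> (d <= \rank M)%N.
Proof.
move=> /diag_codeP/diag_codewordP[M0 MA] nz_M.
have [i nz_i] : exists i, diag_tuple F M i != 0.
  apply/existsP; apply: contraR nz_M => /existsPn Mi0; apply/eqP.
  rewrite (sum_put_diag M0) big1 // => i _.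
  by move/negPn/eqP: (Mi0 i) => ->; rewrite linear0.
case: (@arg_maxnP _ i (fun i => diag_tuple F M i != 0) val nz_i) => {nz_i}i nz_i i_max.
apply: leq_trans (@sum_rank_diag_le M i _); last first.
  move=> b lt_b.
  have [/existsP[j bj]|/existsPn bD] := boolP [exists j, b \in diag_in F j];
    last exact: M0.
  have /ffunP/(_ (enum_rank_in bj b)) : diag_tuple F M j = 0.
    apply: contraTeq lt_b => /i_max /= le_ji; rewrite -leqNgt.
    move: bj; rewrite !inE => /andP[/andP[_ /eqP ->] _].
    by move: le_ji (ltn_ord j) => /=; lia.
  by rewrite !ffunE enum_rankK_in.
have [[_ [_ [_ minA]]]|[_ A0]] := diag_component_cases i; first exact: minA (MA i) nz_i.
by move: (MA i) nz_i; rewrite A0 memv0 => ->.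
Qed.

Lemma diag_code_ferrers :
  ferrers_code F (m * (\sum_(i < s) maxn 0 (m * #|diag_in F i| + 1 - d))) d diag_code.
Proof.
split=> [M /diag_codeP[] //||].
  rewrite dim_diag_code big_distrr /=; apply: eq_bigr => i _.
  rewrite max0n [(m * #|_|)%N]mulnC.
  have [[_ [-> _]] //|[lt_d ->]] := diag_component_cases i.
  have /eqP -> : (#|diag_in F i| * m + 1 - d == 0)%N by rewrite subn_eq0 addn1.
  by rewrite dimv0 muln0.
have [->|nz_C] := eqVneq diag_code 0%VS; first by left.
right; split; last exact: diag_code_rank.
have [i nz_i] : exists i : 'I_s, A #|diag_in F i| != 0%VS.
  apply/existsP; apply: contraR nz_C => /existsPn A0; apply/eqP.
  by rewrite /diag_code big1 // => i _; move/negPn/eqP: (A0 i) => ->; rewrite limg0.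
have [[_ [_ [[X XA [nz_X wtX]] _]]]|[_ A0]] := diag_component_cases i;
  last by rewrite A0 eqxx in nz_i.
have XC : put_diag X \in diag_code.
  rewrite /diag_code (bigD1 i) //= -[put_diag X]addr0 memv_add ?mem0v //.
  by apply/memv_imgP; exists X => //; rewrite lfunE.
have nz_pX : put_diag X != 0 by rewrite put_diag_eq0.
exists (put_diag X) => //; split=> //; apply/eqP.
by rewrite eqn_leq diag_code_rank // -wtX mxrank_put_diag.
Qed.

End DiagonalCode.

Local Close Scope ring_scope.

Theorem lemma3p6 (m s : nat) (F : {set 'I_(s * m) * 'I_(s * m)}) (d : nat)
    (K : finFieldType)
    (hm : 0 < m) (hs : 0 < s) (hF : block_ferrers F) (hd : 1 <= d <= s * m)
    (hq : diag_max F + 1 <= #|K|) :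
  (exists A : (forall j : nat, {vspace {ffun 'I_j -> 'M[K]_m}}),
      msrd_family d (diag_max F) A) /\
  (forall A : (forall j : nat, {vspace {ffun 'I_j -> 'M[K]_m}}),
      msrd_family d (diag_max F) A ->
      exists C : {vspace 'M[K]_(s * m)},
        (forall M : 'M[K]_(s * m), M \in C <-> diag_codeword F A M) /\
        ferrers_code F
          (m * (\sum_(i < s) maxn 0 (m * #|diag_in F i| + 1 - d))) d C).
Proof.
have [d_gt0 _] := andP hd; split.
  by apply: msrd_family_exists => //; rewrite -addn1.
move=> A hA; exists (diag_code F A); split; first exact: diag_codeP.
exact: diag_code_ferrers.
Qed.
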